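(* Let $I\subset[0,\infty)$ be an interval with interior $I^{\circ}$, and let $f:I\to\mathbb{R}$ be a twice differentiable function on $I^{\circ}$ such that $f''\in L_1[a,b]$, where $a,b\in I$ with $a<b$. If $|f''|^q$ is $s$-convex in the second sense on $[a,b]$ for some fixed $s\in(0,1]$ and $q\ge1$, then for each $x\in[a,b]$ $$\left|\frac{1}{b-a}\int_a^b f(u)\,du-f(x)+\left(x-\frac{a+b}{2}\right)f'(x)\right|\le\frac{(x-a)^3}{2(b-a)}\left(\frac13\right)^{1-\frac1q}\left(\frac{|f''(x)|^q}{s+3}+\frac{2|f''(a)|^q}{(s+1)(s+2)(s+3)}\right)^{\frac1q}+\frac{(b-x)^3}{2(b-a)}\left(\frac13\right)^{1-\frac1q}\left(\frac{|f''(x)|^q}{s+3}+\frac{2|f''(b)|^q}{(s+1)(s+2)(s+3)}\right)^{\frac1q}.$$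
   Context: For fixed $s\in(0,1]$, a real-valued function $g$ is $s$-convex in the second sense on $[a,b]\subset[0,\infty)$ if $g(ty+(1-t)z)\le t^s g(y)+(1-t)^s g(z)$ for all $y,z\in[a,b]$ and $t\in[0,1]$. $L_1[a,b]$ denotes the Lebesgue integrable functions on $[a,b]$. *)

(* Defs.v *)
From HB Require Import structures.
From mathcomp Require Import all_boot all_order all_algebra.
From mathcomp Require Import all_classical all_reals all_analysis.

Set Implicit Arguments.
Unset Strict Implicit.
Unset Printing Implicit Defensive.

Import Order.TTheory GRing.Theory Num.Theory.
Import numFieldNormedType.Exports.

Local Open Scope classical_set_scope.
Local Open Scope ring_scope.

(* A function on an interval I is represented by a total function R -> R; only
   its values on I enter these definitions at a point x of I.  They are the
   library's [derivable _ _ 1] and [derive1] with increments h restricted to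
   x + h in I: nothing changes at interior points (lemmas below), and at an
   endpoint of I belonging to I one gets the one-sided derivative. *)
Definition derivable_in (R : realType) (I : set R) (f : R -> R) (x : R) : Prop :=
  cvg (h^-1 *: (f (h + x) - f x) @[h --> within [set h | I (h + x)] 0^']).

Definition derive_in (R : realType) (I : set R) (f : R -> R) (x : R) : R :=
  lim (h^-1 *: (f (h + x) - f x) @[h --> within [set h | I (h + x)] 0^']).

Definition s_convex2 (R : realType) (s : R) (A : set R) (g : R -> R) : Prop :=
  forall y z t : R, A y -> A z -> 0 <= t <= 1 ->
    g (t * y + (1 - t) * z) <= t `^ s * g y + (1 - t) `^ s * g z.

Lemma within_interior (R : realType) (I : set R) (x : R) :
  I° x -> within [set h | I (h + x)] 0^' = 0^'.
Proof.
move=> Ix; have I0 : \forall h \near (0 : R)^', I (h + x).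
  apply: cvg_within; move: Ix => /nbhs0P; rewrite !near_simpl.
  by apply: filterS => h; rewrite addrC.
apply/seteqP; split=> A AI; last by apply: filterS AI => h Ah _.
by move: I0 AI; apply: filterS2 => h Ih; apply.
Qed.

Lemma derivable_in_interior (R : realType) (I : set R) (f : R -> R) (x : R) :
  I° x -> derivable_in I f x = derivable f x 1.
Proof.
move=> Ix; rewrite /derivable_in within_interior // /derivable.
set d := (fun _ : R => _); set d' := (fun _ : R => _).
by suff -> : d = d' by []; rewrite funeqE => h; rewrite /d /d' /= [h%:A](mulr1).
Qed.

Lemma derive_in_interior (R : realType) (I : set R) (f : R -> R) (x : R) :
  I° x -> derive_in I f x = derive1 f x.
Proof. by move=> Ix; rewrite /derive_in within_interior. Qed.

(* Main.v *)
Require Import Defs.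
From HB Require Import structures.
From mathcomp Require Import all_boot all_order all_algebra ring lra.
From mathcomp Require Import all_classical all_reals all_analysis.

Import Order.TTheory GRing.Theory Num.Theory.
Import numFieldNormedType.Exports.

Local Open Scope classical_set_scope.
Local Open Scope ring_scope.

(* The kernel D_e(u) = F(u) - (u - e) f(u) + (u - e)^2 / 2 f'(u), with F a
   primitive of f, satisfies D_e' = (u - e)^2 / 2 f'', and the quantity to bound
   is ((D_a(x) - D_a(a)) - (D_b(x) - D_b(b))) / (b - a).
   By s-convexity |f''(t x + (1 - t) e)| <= h(t)^(1/q), where
   h(t) = t^s |f''(x)|^q + (1 - t)^s |f''(e)|^q.  Instead of Hoelder's
   inequality for the weight t^2, use the tangent line of the concave function
   y^(1/q) at the t^2-mean c of h: it majorizes h^(1/q) by A + B h with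
   A + B c = c^(1/q).  The weight t^2 (A + B h(t)) has an explicit primitive, so
   the mean value theorem suffices and f'' is never integrated. *)

(** * Continuity from differentiability relative to a set *)

Lemma derivable_in_cvg {R : realType} (I : set R) (f : R -> R) (x : R) :
  derivable_in I f x -> f u @[u --> within I (nbhs x)] --> f x.
Proof.
move=> dfx.
have h0 : h @[h --> within [set h | I (h + x)] 0^'] --> (0 : R).
  by apply: cvg_within_filter; apply: cvg_within.
(* The increment is [h] times the difference quotient, hence tends to 0 times the derivative. *)
have fx : h * (h^-1 * (f (h + x) - f x)) @[h --> within [set h | I (h + x)] 0^']
    --> 0 * derive_in I f x by exact: cvgM h0 dfx.
rewrite mul0r in fx.
apply/cvgrPdist_lt => e e0.
have {}fx : \forall h \near within [set h | I (h + x)] 0^',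
    `|h * (h^-1 * (f (h + x) - f x))| < e by exact: cvgr0_norm_lt.
rewrite !near_withinE in fx *; apply/(@nbhs0P R R^o).
apply: filterS fx => h fx Ixh.
have [->|h0'] := eqVneq h 0; first by rewrite addr0 subrr normr0.
by rewrite distrC (addrC x) -[X in `|X|](mulVKf h0') fx//= addrC.
Qed.

Lemma within_derivable_in_continuous {R : realType} (I A : set R) (f : R -> R) :
  A `<=` I -> (forall u, A u -> derivable_in I f u) ->
  {within A, continuous f}.
Proof.
move=> AI df; apply/subspace_continuousP => x Ax.
move=> P /(derivable_in_cvg _ _ _ (df x Ax) _) fP.
change (nbhs x [set u | A u -> P (f u)]).
have {}fP : nbhs x [set u | I u -> P (f u)] := fP.
by apply: filterS fP => u Pu /AI /Pu.
Qed.

Lemma within_continuous_precomp {R : realType} (A B : set R) (f l : R -> R) :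
  (forall t, A t -> B (l t)) -> continuous l ->
  {within B, continuous f} -> {within A, continuous (f \o l)}.
Proof.
move=> AB cl /subspace_continuousP cf; apply/subspace_continuousP => t At.
apply: cvg_comp (cf _ (AB _ At)) => P /(cl t) lP.
change (nbhs t [set u | A u -> P (l u)]).
have {}lP : nbhs t [set u | B (l u) -> P (l u)] := lP.
by apply: filterS lP => u Pu /AB /Pu.
Qed.

(** Differentiability settles the points [0 < t]. At 0 the value is 0 because [0 < p], and it is the
    right limit. *)
Lemma powR_within_continuous {R : realType} (p : R) : 0 < p ->
  {within `[0, 1], continuous (fun t : R => t `^ p)}.
Proof.
move=> p0; apply/continuous_within_itvP => //.
have pc t : 0 < t -> {for t, continuous (fun t : R => t `^ p)}.
  move=> t0; apply/differentiable_continuous/derivable1_diffP.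
  by apply: derivable_powR; rewrite in_itv/= t0.
split.
- by move=> t; rewrite in_itv/= => /andP[t0 _]; exact: pc.
- by rewrite powR0 ?gt_eqF//; exact: powR_cvg0.
- by apply: cvg_at_left_filter; exact: pc.
Qed.

(** * Tangent-line bound for concave powers *)

Lemma le_powR_tangent {R : realType} (p c y : R) : 0 < p <= 1 -> 0 < c -> 0 <= y ->
  y `^ p <= (1 - p) * c `^ p + p * c `^ (p - 1) * y.
Proof.
(* The case [p = 1] is split off: the exponent 1 / (1 - p) used below would be infinite. *)
move=> /andP[p0]; rewrite le_eqVlt => /predU1P[->|p1] c0 y0.
  by rewrite subrr mul0r add0r powRr0 mulr1 mul1r powRr1.
have q0 : 0 < 1 - p by rewrite subr_gt0.
have pq1 : p^-1^-1 + (1 - p)^-1^-1 = 1 by rewrite !invrK; ring.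
(* Young's inequality with exponents 1 / p and 1 / (1 - p) gives y^p c^(1-p) <= p y + (1 - p) c;
   dividing by c^(1-p) gives the tangent bound. *)
have := @conjugate_powR R (y `^ p) (c `^ (1 - p)) p^-1 (1 - p)^-1.
rewrite -!powRrM !mulfV ?gt_eqF// !powRr1 ?(ltW c0)// !invrK.
rewrite !invr_gt0 => /(_ (powR_ge0 _ _) (powR_ge0 _ _) p0 q0).
rewrite !invrK in pq1 * => /(_ pq1) yc.
have cE : c `^ p * c `^ (1 - p) = c.
  by rewrite -powRD ?(gt_eqF c0) ?implybT// pq1 powRr1 ?ltW.
have cE1 : c `^ (p - 1) * c `^ (1 - p) = 1.
  by rewrite -[1 - p]opprB powRN mulfV// gt_eqF// powR_gt0.
rewrite -(ler_pM2r (powR_gt0 (1 - p) c0)) (le_trans yc)//.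
have -> : ((1 - p) * c `^ p + p * c `^ (p - 1) * y) * c `^ (1 - p) =
    (1 - p) * (c `^ p * c `^ (1 - p)) + p * (c `^ (p - 1) * c `^ (1 - p)) * y.
  by ring.
by rewrite cE cE1; lra.
Qed.

(* The tangent at [c] is vertical when [c = 0], whence the last premise. *)
Lemma powR_concave_majorant {R : realType} (p c : R) : 0 < p <= 1 -> 0 <= c ->
  exists A B : R, A + B * c = c `^ p /\
    forall y, 0 <= y -> (c = 0 -> y = 0) -> y `^ p <= A + B * y.
Proof.
move=> p01; rewrite le_eqVlt => /predU1P[<-|c0].
  exists 0, 0; split; first by rewrite mul0r addr0 powR0// gt_eqF//; case/andP: p01.
  move=> y _ /(_ erefl) ->.
  by rewrite mul0r addr0 powR0// gt_eqF//; case/andP: p01.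
exists ((1 - p) * c `^ p), (p * c `^ (p - 1)); split; last first.
  by move=> y y0 _; exact: le_powR_tangent.
have <- : c * c `^ (p - 1) = c `^ p by apply: mulr_powRB1; [exact: ltW|case/andP: p01].
by ring.
Qed.

(** * Comparison of increments and the weighted power-mean bound *)

Lemma le_increment {R : realType} (D M dD dM : R -> R) (a b : R) : a < b ->
  {within `[a, b], continuous D} -> {within `[a, b], continuous M} ->
  (forall t : R, t \in `]a, b[%R -> is_derive t 1 D (dD t)) ->
  (forall t : R, t \in `]a, b[%R -> is_derive t 1 M (dM t)) ->
  (forall t : R, t \in `]a, b[%R -> `|dD t| <= dM t) ->
  `|D b - D a| <= M b - M a.
Proof.
move=> ab cD cM dDP dMP leDM; rewrite ler_norml; apply/andP; split.
(* The bound on [dD] makes the derivatives of [M + D] and [M - D] nonnegative, so by the mean value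
   theorem both have nonnegative increments. *)
- have [c cab] : exists2 c, c \in `]a, b[%R &
      (M + D) b - (M + D) a = (dM c + dD c) * (b - a).
    apply: MVT => //; last exact: within_continuousD.
    by move=> t tab; apply: is_deriveD; [exact: dMP|exact: dDP].
  have := leDM _ cab; rewrite ler_norml => /andP[lo _].
  have : 0 <= (dM c + dD c) * (b - a) by apply: mulr_ge0; lra.
  by move=> + E; rewrite -E !fctE; lra.
- have [c cab] : exists2 c, c \in `]a, b[%R &
      (M - D) b - (M - D) a = (dM c - dD c) * (b - a).
    apply: MVT => //; last exact: within_continuousB.
    by move=> t tab; apply: is_deriveB; [exact: dMP|exact: dDP].
  have := leDM _ cab; rewrite ler_norml => /andP[_ hi].
  have : 0 <= (dM c - dD c) * (b - a) by apply: mulr_ge0; lra.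
  by move=> + E; rewrite -E !fctE; lra.
Qed.

(** A primitive of t^2 (t^s X + (1 - t)^s E). The factor of [E] comes from expanding t^2 = 1 - 2 (1
    - t) + (1 - t)^2 and integrating term by term. *)
Definition sconvex_moment {R : realType} (s X E t : R) : R :=
  X * (t `^ (s + 3) / (s + 3)) -
  E * ((1 - t) `^ (s + 1) / (s + 1) - 2 * ((1 - t) `^ (s + 2) / (s + 2))
       + (1 - t) `^ (s + 3) / (s + 3)).

(** These are the integrals of t^(s+2) and t^2 (1 - t)^s over [0, 1]; the second is the Beta value
    B(3, s + 1). *)
Lemma sconvex_moment_increment {R : realType} (s X E : R) : 0 < s ->
  sconvex_moment s X E 1 - sconvex_moment s X E 0 =
  X / (s + 3) + 2 * E / ((s + 1) * (s + 2) * (s + 3)).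
Proof.
move=> s0; rewrite /sconvex_moment subrr subr0 powR1 !powR0 ?gt_eqF ?addr_gt0//.
by field; rewrite !gt_eqF ?addr_gt0.
Qed.

Lemma is_derive_onem_powR {R : realType} (p t : R) : t < 1 ->
  is_derive t 1 (fun u : R => (1 - u) `^ p) (- (p * (1 - t) `^ (p - 1))).
Proof.
move=> t1.
have := @is_derive1_comp R (fun u => u `^ p) (fun u => 1 - u) t
  (p * (1 - t) `^ (p - 1)) (-1).
rewrite mulrN1; apply; first by apply: is_derive1_powR; rewrite subr_gt0.
by rewrite -sub0r; apply: is_deriveB.
Qed.

Lemma is_derive_sconvex_moment {R : realType} (s X E t : R) : 0 < s -> 0 < t < 1 ->
  is_derive t 1 (sconvex_moment s X E) (t ^+ 2 * (t `^ s * X + (1 - t) `^ s * E)).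
Proof.
move=> s0 /andP[t0 t1]; rewrite /sconvex_moment.
have t1' : 0 < 1 - t by rewrite subr_gt0.
have dX : is_derive t 1 (fun u : R => u `^ (s + 3)) ((s + 3) * t `^ (s + 2)).
  by rewrite (_ : s + 2 = s + 3 - 1); [exact: is_derive1_powR|ring].
have d1 := is_derive_onem_powR (s + 1) t t1.
have d2 := is_derive_onem_powR (s + 2) t t1.
have d3 := is_derive_onem_powR (s + 3) t t1.
apply: is_derive_eq; rewrite /GRing.scale/=.
have E1 : s + 1 - 1 = s by ring.
have E2 : s + 2 - 1 = s + 1 by ring.
have E3 : s + 3 - 1 = s + 2 by ring.
have P x : 0 < x -> x `^ (s + 1) = x `^ s * x /\ x `^ (s + 2) = x `^ s * x ^+ 2.
  move=> x0; split; rewrite powRD ?(gt_eqF x0) ?implybT//.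
    by rewrite powRr1 ?ltW.
  by rewrite powR_mulrn ?ltW.
rewrite E1 E2 E3; have [-> ->] := P _ t1'; have [_ ->] := P _ t0.
by field; rewrite !gt_eqF ?addr_gt0.
Qed.

Lemma within_continuous_sconvex_moment {R : realType} (s X E : R) : 0 < s ->
  {within `[0, 1], continuous (sconvex_moment s X E)}.
Proof.
move=> s0; have c0 p : 0 < p -> {within `[0, 1], continuous (fun t : R => t `^ p)}.
  exact: powR_within_continuous.
have c1 p : 0 < p -> {within `[0, 1], continuous (fun t : R => (1 - t) `^ p)}.
  move=> p0; apply: (@within_continuous_precomp R _ `[0, 1]
    (fun t : R => t `^ p) (fun t => 1 - t)).
  - by move=> t /=; rewrite !in_itv/=; lra.
  - by move=> t; apply: cvgB; [exact: cvg_cst|exact: cvg_id].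
  - exact: c0.
move=> t; apply: cvgB.
  apply: cvgMl_tmp; apply: cvgMr_tmp; apply: c0; lra.
apply: cvgMl_tmp; apply: cvgD; last by apply: cvgMr_tmp; apply: c1; lra.
apply: cvgB; first by apply: cvgMr_tmp; apply: c1; lra.
by apply: cvgMl_tmp; apply: cvgMr_tmp; apply: c1; lra.
Qed.

(** The power-mean inequality for the weight t^2, stated for increments: 1/3 is the mass of the
    weight, and the last base is the weighted integral of h. *)
Lemma powR_weighted_increment {R : realType} (s p k X E : R) (D dD : R -> R) :
  0 < s -> 0 < p <= 1 -> 0 <= k -> 0 <= X -> 0 <= E ->
  {within `[0, 1], continuous D} ->
  (forall t : R, t \in `]0, 1[%R -> is_derive t 1 D (dD t)) ->
  (forall t : R, t \in `]0, 1[%R ->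
     `|dD t| <= k * (t ^+ 2 * (t `^ s * X + (1 - t) `^ s * E) `^ p)) ->
  `|D 1 - D 0| <= k * (1 / 3) `^ (1 - p) *
    (X / (s + 3) + 2 * E / ((s + 1) * (s + 2) * (s + 3))) `^ p.
Proof.
move=> s0 p01 k0 X0 E0 cD dDP ledD.
set S := X / (s + 3) + _.
have S1 : 0 <= X / (s + 3) by rewrite divr_ge0// addr_ge0// ltW.
have S2 : 0 <= 2 * E / ((s + 1) * (s + 2) * (s + 3)).
  by rewrite divr_ge0 ?mulr_ge0 ?addr_ge0// ltW.
(* 3 S is the mean of h for the probability density 3 t^2 on [0, 1]. *)
have S3 : 0 <= 3 * S by rewrite mulr_ge0 ?addr_ge0.
have [A [B [ABS AB]]] := powR_concave_majorant p (3 * S) p01 S3.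
(* Since (1/3)^(1-p) = 3^p / 3, the bound is k (3 S)^p / 3, which the choice of [A] and [B] makes
   affine in [S]. *)
have -> : k * (1 / 3) `^ (1 - p) * S `^ p = k * (A / 3 + B * S).
  have -> : A / 3 + B * S = (A + B * (3 * S)) / 3 by field.
  have -> : (1 / 3 : R) `^ (1 - p) = 3 `^ p / 3.
    rewrite div1r -[in LHS]powR_inv1 ?ler0n// -powRrM mulN1r opprB.
    rewrite powRB ?pnatr_eq0 ?implybT//.
    by rewrite powRr1 ?ler0n.
  by rewrite ABS powRM ?ler0n ?addr_ge0//; ring.
pose M (t : R) := k * (A * (t ^+ 3 / 3) + B * sconvex_moment s X E t).
have -> : k * (A / 3 + B * S) = M 1 - M 0.
  rewrite /M /S -sconvex_moment_increment// expr1n expr0n/=; ring.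
apply: (@le_increment _ D M dD
  (fun t => k * (A * t ^+ 2 + B * (t ^+ 2 * (t `^ s * X + (1 - t) `^ s * E))))
  _ _ ltr01 cD).
- rewrite /M; move=> t; apply: cvgMl_tmp; apply: cvgD; apply: cvgMl_tmp.
    apply: cvgMr_tmp; apply: (@continuous_subspaceT _ _ _ (fun t : R => t ^+ 3)).
    exact: exprn_continuous.
  exact: within_continuous_sconvex_moment.
- move=> t; rewrite in_itv/= => t01.
  have dm := is_derive_sconvex_moment s X E t s0 t01.
  by apply: is_derive_eq; rewrite /GRing.scale/= /M; field.
- move=> t t01; apply: (le_trans (ledD _ t01)); rewrite ler_wpM2l//.
  move: t01; rewrite in_itv/= => /andP[t0 t1].
  set h := t `^ s * X + (1 - t) `^ s * E.
  have -> : A * t ^+ 2 + B * (t ^+ 2 * h) = t ^+ 2 * (A + B * h) by ring.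
  rewrite ler_wpM2l ?exprn_ge0 ?(ltW t0)//.
  apply: AB; first by rewrite addr_ge0// mulr_ge0// powR_ge0.
  (* A zero mean forces both nonnegative summands of [S] to vanish, so [X] and [E] are 0 and h is
     0. *)
  move=> /eqP; rewrite mulf_eq0 pnatr_eq0/= paddr_eq0// => /andP[/eqP XS /eqP ES].
  rewrite /h.
  have -> : X = X / (s + 3) * (s + 3) by field; rewrite gt_eqF ?addr_gt0.
  have -> : E = 2 * E / ((s + 1) * (s + 2) * (s + 3)) *
      ((s + 1) * (s + 2) * (s + 3) / 2).
    by field; rewrite !gt_eqF ?addr_gt0.
  by rewrite XS ES !mul0r !mulr0 addr0.
Qed.

(** * Increment of the kernel between an endpoint and x *)

Lemma segment_increment_le {R : realType} (F f f1 f2 : R -> R) (a b e x s q : R) :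
  0 < s -> 1 <= q -> a <= e <= b -> a <= x <= b ->
  {within `[a, b], continuous F} -> {within `[a, b], continuous f} ->
  {within `[a, b], continuous f1} ->
  (forall u : R, u \in `]a, b[%R -> is_derive u 1 F (f u)) ->
  (forall u : R, u \in `]a, b[%R -> is_derive u 1 f (f1 u)) ->
  (forall u : R, u \in `]a, b[%R -> is_derive u 1 f1 (f2 u)) ->
  s_convex2 s `[a, b] (fun u => `|f2 u| `^ q) ->
  `|F x - (x - e) * f x + (x - e) ^+ 2 / 2 * f1 x - F e| <=
  `|x - e| ^+ 3 / 2 * (1 / 3) `^ (1 - 1 / q) *
    (`|f2 x| `^ q / (s + 3) +
     2 * `|f2 e| `^ q / ((s + 1) * (s + 2) * (s + 3))) `^ (1 / q).
Proof.
move=> s0 q1 eab xab cF cf cf1 dF df df1 cvx.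
pose D u := F u - (u - e) * f u + (u - e) ^+ 2 / 2 * f1 u.
have q0 : 0 < q by lra.
have -> : F x - (x - e) * f x + (x - e) ^+ 2 / 2 * f1 x - F e = D x - D e.
  by rewrite /D subrr; ring.
(* For [x = e] the path [l] below is constant and may stay at an endpoint, outside []a, b[]. *)
have [->|xe] := eqVneq x e.
  by rewrite subrr normr0 mulr_ge0 ?powR_ge0// mulr_ge0 ?powR_ge0// divr_ge0.
(* Parametrizing from [e] to [x] treats both orders of [e] and [x] at once. *)
pose l (t : R) := t * x + (1 - t) * e.
have lab (t : R) : 0 <= t <= 1 -> a <= l t <= b by rewrite /l; nra.
have loab (t : R) : 0 < t < 1 -> l t \in `]a, b[%R.
  by rewrite in_itv/= /l; move: xe; rewrite neq_lt => /orP[]; nra.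
have -> : D x - D e = (D \o l) 1 - (D \o l) 0.
  by rewrite /= /l subrr subr0 !mul1r !mul0r addr0 add0r.
have cD : {within `[0, 1], continuous (D \o l)}.
  apply: (@within_continuous_precomp _ _ `[a, b]).
  + by move=> t; rewrite /= !in_itv/=; exact: lab.
  + move=> t; apply: cvgD; apply: cvgMr_tmp; first exact: cvg_id.
    by apply: cvgB; [exact: cvg_cst|exact: cvg_id].
  have cpoly (g : R -> R) : continuous g -> {within `[a, b], continuous g}.
    exact: continuous_subspaceT.
  have c1 : continuous (fun u : R => u - e).
    by move=> u; apply: cvgB; [exact: cvg_id|exact: cvg_cst].
  have c2 : continuous (fun u : R => (u - e) ^+ 2 / 2).
    by move=> u; apply: cvgMr_tmp; apply: cvgM; exact: c1.
  move=> u; apply: cvgD; first apply: cvgB.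
  + exact: cF.
  + by apply: cvgM; [exact: (cpoly _ c1 u)|exact: cf].
  + by apply: cvgM; [exact: (cpoly _ c2 u)|exact: cf1].
have dD (t : R) : t \in `]0, 1[%R ->
    is_derive t 1 (D \o l) ((l t - e) ^+ 2 / 2 * f2 (l t) * (x - e)).
  rewrite in_itv/= => t01; have ltab := loab _ t01.
  apply: is_derive1_comp.
    have dFl := dF _ ltab; have dfl := df _ ltab; have df1l := df1 _ ltab.
    by apply: is_derive_eq; rewrite /GRing.scale/=; field.
  by apply: is_derive_eq; rewrite /GRing.scale/=; ring.
have leD (t : R) : t \in `]0, 1[%R ->
    `|(l t - e) ^+ 2 / 2 * f2 (l t) * (x - e)| <= `|x - e| ^+ 3 / 2 *
      (t ^+ 2 * (t `^ s * `|f2 x| `^ q + (1 - t) `^ s * `|f2 e| `^ q) `^ (1 / q)).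
  rewrite in_itv/= => /andP[t0 t1].
  (* Two of the three factors [x - e] come from this square, the third from the derivative of
     [l]. *)
  have -> : l t - e = t * (x - e) by rewrite /l; ring.
  rewrite !normrM (gtr0_norm t0) (ger0_norm (_ : 0 <= 2^-1))// ?invr_ge0//.
  have -> : t * `|x - e| * (t * `|x - e|) / 2 * `|f2 (l t)| * `|x - e| =
    `|x - e| ^+ 3 / 2 * (t ^+ 2 * `|f2 (l t)|) by ring.
  apply: ler_wpM2l; first by rewrite divr_ge0.
  apply: ler_wpM2l; first by rewrite exprn_ge0// ltW.
  (* Writing |f''| as the 1/q-th power of |f''|^q lets s-convexity act under a monotone power. *)
  have {1}-> : `|f2 (l t)| = (`|f2 (l t)| `^ q) `^ (1 / q).
    by rewrite -powRrM div1r mulfV ?gt_eqF// powRr1.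
  apply: ge0_ler_powR.
  + by rewrite divr_ge0// ltW.
  + by rewrite nnegrE powR_ge0.
  + by rewrite nnegrE addr_ge0// mulr_ge0 ?powR_ge0.
  by apply: cvx; rewrite /= ?in_itv/= ?(ltW t0) ?(ltW t1).
have p01 : 0 < 1 / q <= 1 by rewrite div1r invr_gt0 q0 invf_le1.
have k0 : 0 <= `|x - e| ^+ 3 / 2 by rewrite divr_ge0.
exact: (powR_weighted_increment s (1 / q) _ _ _ (D \o l) _ s0 p01 k0
  (powR_ge0 _ _) (powR_ge0 _ _) cD dD leD).
Qed.

(** * Primitive of f and assembly of the two segments *)

Lemma continuous_primitive {R : realType} (f : R -> R) (a b : R) : a < b ->
  {within `[a, b], continuous f} ->
  let F u := \int[@lebesgue_measure R]_(v in `[a, u]) f v in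
  {within `[a, b], continuous F} /\
  forall u, u \in `]a, b[%R -> is_derive u 1 F (f u).
Proof.
move=> ab cf F.
have fi : (@lebesgue_measure R).-integrable `[a, b] (EFin \o f).
  by apply: continuous_compact_integrable => //; exact: segment_compact.
split; first exact: (parameterized_integral_continuous (ltW ab) fi).
move=> u uab; move: (uab); rewrite in_itv/= => /andP[au ub].
have [dF Ff] := continuous_FTC1_closed ub fi au
  (within_continuous_continuous ab cf uab).
by rewrite -Ff derive1E; exact: derivableP.
Qed.

Theorem theorem6 (R : realType) (I : set R) (f : R -> R) (a b s q : R)
  (I_itv : is_interval I)
  (I_ge0 : I `<=` [set u | 0 <= u])
  (Ia : I a) (Ib : I b) (ab : a < b)
  (s_bnd : 0 < s <= 1) (q_ge1 : 1 <= q)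
  (f_twice : forall u, (I° `|` `[a, b]) u ->
     derivable_in I f u /\ derivable_in I (derive_in I f) u)
  (f2_L1 : (@lebesgue_measure R).-integrable `[a, b]
     (EFin \o derive_in I (derive_in I f)))
  (f2_conv : s_convex2 s `[a, b]
     (fun u => `|derive_in I (derive_in I f) u| `^ q)) :
  forall x : R, a <= x <= b ->
  `| (b - a)^-1 * (\int[@lebesgue_measure R]_(u in `[a, b]) f u)%R - f x
     + (x - (a + b) / 2) * derive_in I f x | <=
  (x - a) ^+ 3 / (2 * (b - a)) * (1 / 3) `^ (1 - 1 / q) *
    (`|derive_in I (derive_in I f) x| `^ q / (s + 3) +
     2 * `|derive_in I (derive_in I f) a| `^ q
       / ((s + 1) * (s + 2) * (s + 3))) `^ (1 / q) +
  (b - x) ^+ 3 / (2 * (b - a)) * (1 / 3) `^ (1 - 1 / q) *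
    (`|derive_in I (derive_in I f) x| `^ q / (s + 3) +
     2 * `|derive_in I (derive_in I f) b| `^ q
       / ((s + 1) * (s + 2) * (s + 3))) `^ (1 / q).
Proof.
move=> x xab.
set f1 := derive_in I f in f_twice f2_L1 f2_conv *.
set f2 := derive_in I f1 in f2_L1 f2_conv *.
have Iab : `[a, b] `<=` I.
  by move=> u; rewrite /= in_itv/= => uab; exact: (I_itv a b).
(* Inside []a, b[] the relative derivatives are therefore the ordinary ones. *)
have Iint u : u \in `]a, b[%R -> I° u.
  move=> uab; apply: filterS (near_in_itvoo uab) => v vab.
  by apply: Iab; exact: subset_itv_oo_cc.
have df u : u \in `]a, b[%R -> is_derive u 1 f (f1 u).
  move=> /Iint Iu; have [+ _] := f_twice _ (or_introl Iu).
  by rewrite derivable_in_interior// /f1 derive_in_interior// derive1E => /derivableP.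
have df1 u : u \in `]a, b[%R -> is_derive u 1 f1 (f2 u).
  move=> /Iint Iu; have [_ +] := f_twice _ (or_introl Iu).
  by rewrite derivable_in_interior// /f2 derive_in_interior// derive1E => /derivableP.
(* Here [a] and [b] may be endpoints of [I]; the one-sided derivatives still give continuity up to
   them. *)
have cf : {within `[a, b], continuous f}.
  by apply: within_derivable_in_continuous Iab _ => u uab;
     have [] := f_twice u (or_intror uab).
have cf1 : {within `[a, b], continuous f1}.
  by apply: within_derivable_in_continuous Iab _ => u uab;
     have [] := f_twice u (or_intror uab).
have [s0 _] := andP s_bnd.
have [] := continuous_primitive f a b ab cf.
set F := fun u : R => (\int[@lebesgue_measure R]_(v in `[a, u]) f v)%R => cF dF.
have Fa : F a = 0 by rewrite /F set_itv1 Rintegral_set1.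
have aab : a <= a <= b by rewrite lexx ltW.
have bab : a <= b <= b by rewrite lexx ltW.
have lea := segment_increment_le F f f1 f2 a b a x s q
  s0 q_ge1 aab xab cF cf cf1 dF df df1 f2_conv.
have leb := segment_increment_le F f f1 f2 a b b x s q
  s0 q_ge1 bab xab cF cf cf1 dF df df1 f2_conv.
have [ax xb] := andP xab.
have ba0 : 0 < b - a by rewrite subr_gt0.
rewrite -/(F b).
rewrite (ger0_norm (_ : 0 <= x - a)) ?subr_ge0// in lea.
rewrite (distrC x b) (ger0_norm (_ : 0 <= b - x)) ?subr_ge0// in leb.
set Da := F x - _ + _ - F a in lea; set Db := F x - _ + _ - F b in leb.
(* F(x) cancels in [Da - Db], f(x) gets the coefficient -(b - a), and f'(x) gets ((x - a)^2 - (x -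
   b)^2) / 2 = (b - a) (x - (a + b) / 2). *)
have -> : (b - a)^-1 * F b - f x + (x - (a + b) / 2) * f1 x = (b - a)^-1 * (Da - Db).
  by rewrite /Da /Db Fa; field; rewrite gt_eqF.
rewrite normrM gtr0_norm ?invr_gt0//.
have scale (y c1 c2 K P Q : R) : y <= c1 / 2 * K * P + c2 / 2 * K * Q ->
    (b - a)^-1 * y <= c1 / (2 * (b - a)) * K * P + c2 / (2 * (b - a)) * K * Q.
  rewrite -[y <= _](ler_pM2l (_ : 0 < (b - a)^-1)) ?invr_gt0//.
  move=> le_y; apply: (le_trans le_y); rewrite le_eqVlt; apply/orP; left.
  by apply/eqP; field; rewrite gt_eqF.
apply: scale; exact: le_trans (ler_normB Da Db) (lerD lea leb).
Qed.
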